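(* Suppose $U\in\mathcal{CU}_\mu(\mathcal H)$. Then $\mathfrak h(U_J)\le\mathfrak h(U_{J+1})$ for every $J\ge1$.
   Context: Let $\mu_j>0$ ($j\in\mathbb N_0=\{0,1,\dots\}$) with $\sum_j\mu_j=1$. $\mathcal H=l^2(\mathbb N_0,\mu)$ is the Hilbert space of complex sequences with $\langle x,y\rangle=\sum_j\mu_jx_j\overline{y_j}$, $\|x\|=\sqrt{\langle x,x\rangle}$. $\mathcal{CU}_\mu(\mathcal H)$ is the set of bounded linear operators $U$ on $\mathcal H$ with $\|Ux\|\le\|x\|$ for all $x$. Matrix entries: $(Ux)_j=\sum_kU_{jk}x_k$. For $J\ge1$ let $U_J:\mathbb C^J\to\mathbb C^J$ be the truncation $U_J=p_JUq_J$, where $p_J(x_0,x_1,\dots)=(x_0,\dots,x_{J-1})$ and $q_J(x_0,\dots,x_{J-1})=(x_0,\dots,x_{J-1},0,\dots)$; its matrix is $(U_{jk})_{j,k<J}$. Let $\mathbf B_J=b(U_J)$ be the $J\times J$ matrix with entries $\frac{\mu_j}{\mu_k}|U_{jk}|^2$. $\mathcal P_{\mathrm{Ker}(\mathbf B_J-I)}$ is the projection of $\mathbb C^J$ onto $\mathrm{Ker}(\mathbf B_J-I)$ along $\mathrm{Im}(\mathbf B_J-I)$ (these are complementary), $\mathcal P^T$ its transpose. With $\mu^{(J)}=(\mu_0,\dots,\mu_{J-1})$, $e=(1,\dots,1)\in\mathbb C^J$, $0\log0=0$, the entropy of $U_J$ is $$\mathfrak h(U_J)=-\sum_{j,k=0}^{J-1}\big(\mathcal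 P^T_{\mathrm{Ker}(\mathbf B_J-I)}e\big)_j(\mathbf B_J)_{jk}\big(\mathcal P_{\mathrm{Ker}(\mathbf B_J-I)}\mu^{(J)}\big)_k\log(\mathbf B_J)_{jk}.$$ *)

(* Defs.v *)
From HB Require Import structures.
From mathcomp Require Import all_boot all_order all_algebra.
From mathcomp Require Import all_classical all_reals all_analysis.
From mathcomp Require Import complex ring lra.
Set Implicit Arguments.
Unset Strict Implicit.
Unset Printing Implicit Defensive.
Import Order.TTheory GRing.Theory Num.Theory.
Import numFieldNormedType.Exports.
Local Open Scope classical_set_scope.
Local Open Scope ring_scope.

Record prob_weight (R : realType) := ProbWeight {
  weight :> nat -> R;
  weight_gt0 : forall j, 0 < weight j;
  weight_sum1 : series weight @ \oo --> (1 : R) }.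

Section WeightedL2.
Context (R : realType) (mu : prob_weight R).

(* Scalars are written R[i]^o because R[i] is canonically a module over R
   only, and because R[i]^o carries the topology. *)
Definition l2_pred : {pred nat -> R[i]^o} :=
  mem [set x : nat -> R[i]^o
      | cvgn (series (fun j => mu j * Normc.normc (x j) ^+ 2))].

Lemma l2_predP (x : nat -> R[i]^o) :
  x \in l2_pred <-> cvgn (series (fun j => mu j * Normc.normc (x j) ^+ 2)).
Proof. by split=> [/set_mem|/mem_set]. Qed.

Lemma l2_submod_closed : submod_closed l2_pred.
Proof.
have mu_ge0 j : 0 <= mu j by rewrite ltW ?weight_gt0.
have nge0 (z : R[i]) : 0 <= Normc.normc z by case: z => ? ?; exact: sqrtr_ge0.
split.
  apply/l2_predP; rewrite (_ : series _ = cst 0); first exact: is_cvg_cst.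
  apply/funext => n; rewrite seriesEnat; apply: big1 => j _.
  rewrite (_ : Normc.normc _ = 0) ?expr0n ?mulr0 //; exact: Normc.normc0.
move=> a x y /l2_predP x2 /l2_predP y2; apply/l2_predP.
pose u := (2 * Normc.normc a ^+ 2) *: (fun j => mu j * Normc.normc (x j) ^+ 2)
          + 2 *: (fun j => mu j * Normc.normc (y j) ^+ 2) : nat -> R.
have uE j : u j = mu j * (2 * Normc.normc (a * x j) ^+ 2
                          + 2 * Normc.normc (y j) ^+ 2).
  rewrite Normc.normcM.
  suff -> : u j = 2 * Normc.normc a ^+ 2 * (mu j * Normc.normc (x j) ^+ 2)
                + 2 * (mu j * Normc.normc (y j) ^+ 2) by ring.
  by [].
apply: (@series_le_cvg _ _ u) => [j|j|j|].
- by rewrite mulr_ge0 ?sqr_ge0.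
- by rewrite uE mulr_ge0 // addr_ge0 // mulr_ge0 ?sqr_ge0.
- rewrite uE ler_wpM2l //.
  have /= tri := le_normcD (a * x j) (y j).
  apply: (@le_trans _ _ ((Normc.normc (a * x j) + Normc.normc (y j)) ^+ 2)).
    by rewrite ler_pXn2r ?nnegrE ?addr_ge0.
  rewrite -subr_ge0.
  have := sqr_ge0 (Normc.normc (a * x j) - Normc.normc (y j)).
  by congr (_ <= _); ring.
- by apply: is_cvg_seriesD; exact: is_cvg_seriesZ.
Qed.

HB.instance Definition _ := GRing.isSubmodClosed.Build R[i] (nat -> R[i]^o)
  l2_pred l2_submod_closed.

Record l2 := L2 { l2_fun :> nat -> R[i]^o; l2_funP : l2_fun \in l2_pred }.

HB.instance Definition _ := [isSub for l2_fun].
HB.instance Definition _ := [Choice of l2 by <:].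
HB.instance Definition _ := [SubChoice_isSubLmodule of l2 by <:].

Definition l2_dot (x y : l2) : R[i] :=
  limn (series (fun j => (mu j)%:C%C * x j * (y j)^* : R[i]^o)).

Definition l2_norm (x : l2) : R[i] := sqrtC (l2_dot x x).

(* Boundedness is not repeated: it is this inequality, with bound 1. *)
Definition l2_contraction (U : {linear l2 -> l2}) : Prop :=
  forall x, l2_norm (U x) <= l2_norm x.

Definition l2_restrict (J : nat) (x : l2) : 'cV[R[i]]_J := \col_j x j.

Definition extend0 (J : nat) (v : 'cV[R[i]]_J) : nat -> R[i]^o :=
  fun k => oapp (fun i : 'I_J => v i 0) 0 (insub k).

Lemma extend0_l2 J (v : 'cV[R[i]]_J) : extend0 v \in l2_pred.
Proof.
apply/l2_predP; rewrite -(is_cvg_series_restrict J).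
rewrite (_ : (fun n => _) = cst 0); first exact: is_cvg_cst.
apply/funext => n; rewrite big_nat big1 // => k /andP[Jk _].
by rewrite /extend0 insubN ?Normc.normc0 ?expr0n ?mulr0 // -leqNgt.
Qed.

Definition l2_extend J (v : 'cV[R[i]]_J) : l2 := L2 (extend0_l2 v).

Definition trunc (U : l2 -> l2) (J : nat) (v : 'cV[R[i]]_J) : 'cV[R[i]]_J :=
  l2_restrict J (U (l2_extend v)).

(* A linear map of C^J is given by its matrix acting on columns; column k is
   the image of the k-th basis vector. *)
Definition trunc_mx (U : l2 -> l2) (J : nat) : 'M[R[i]]_J :=
  \matrix_(j, k) trunc U (delta_mx k 0) j 0.

Definition b_mx J (A : 'M[R[i]]_J) : 'M[R]_J :=
  \matrix_(j, k) (mu j / mu k * Normc.normc (A j k) ^+ 2).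

End WeightedL2.

(* MathComp subspaces are row spaces and proj_mx acts on row vectors, hence the
   transpositions. *)
Definition ker_im_proj (F : fieldType) (n : nat) (A : 'M[F]_n) : 'M[F]_n :=
  (proj_mx (kermx A^T) A^T)^T.

Lemma ker_im_proj_id (F : fieldType) (n : nat) (A : 'M[F]_n) (x : 'cV[F]_n) :
  (kermx A^T :&: A^T)%MS = 0 -> A *m x = 0 -> ker_im_proj A *m x = x.
Proof.
move=> dx Ax0; apply: trmx_inj; rewrite trmx_mul trmxK proj_mx_id //.
by apply/sub_kermxP; rewrite -trmx_mul Ax0 trmx0.
Qed.

Lemma ker_im_proj0 (F : fieldType) (n : nat) (A : 'M[F]_n) (y : 'cV[F]_n) :
  (kermx A^T :&: A^T)%MS = 0 -> ker_im_proj A *m (A *m y) = 0.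
Proof.
move=> dx; apply: trmx_inj; rewrite !trmx_mul trmxK trmx0 proj_mx_0 //.
exact: submxMl.
Qed.

(* The value is kept in R[i], as the projection lives on C^J: for contractions
   it is real, and the order of R[i] restricts to the usual one on reals.
   The convention 0 * log 0 = 0 holds since ln 0 = 0. *)
Definition entropy (R : realType) (mu : prob_weight R) (J : nat)
    (A : 'M[R[i]]_J) : R[i] :=
  let B := b_mx mu A in
  let P := ker_im_proj (map_mx (real_complex R) B - 1%:M) in
  let e : 'cV[R[i]]_J := const_mx 1 in
  let muJ : 'cV[R[i]]_J := \col_k (mu k)%:C%C in
  - \sum_j \sum_k
      (P^T *m e) j 0 * (B j k)%:C%C * (P *m muJ) k 0 * (ln (B j k))%:C%C.

(* Main.v *)
Require Import Defs.
From mathcomp Require Import all_boot all_order all_algebra.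
From mathcomp Require Import all_classical all_reals all_analysis.
From mathcomp Require Import complex ring.
Import Order.TTheory GRing.Theory Num.Theory.
Import numFieldNormedType.Exports.
Local Open Scope classical_set_scope.
Local Open Scope ring_scope.
Set Implicit Arguments.
Unset Strict Implicit.
Unset Printing Implicit Defensive.

(** Testing the contraction on basis vectors shows that the nonnegative matrix
    B_J has column sums at most 1. Hence its powers are bounded, which makes
    Ker(B_J - I) and Im(B_J - I) complementary and the projection P_J the limit
    of the Cesaro means of the powers of B_J. As B_J is a submatrix of B_(J+1),
    these means, hence also P_J, are nonnegative and entrywise at most those for
    J+1. The entries of B_J lie in [0, 1], so every term of the sum defining the
    entropy is nonnegative and grows when J is replaced by J+1. *)

(** * Archimedean criteria in [R[i]], and sums of nonnegative terms *)

Lemma norm_complexE (R : realType) (z : R[i]) :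
  `|z| = (Normc.normc z)%:C%C.
Proof. by []. Qed.

(** The Archimedean property of [R], carried over to [R[i]]. It replaces dividing by [n] and passing
    to the limit. *)
Lemma complex_natmul_bounded (R : realType) (z c : R[i]) :
  (forall n, `|z| *+ n <= c) -> z = 0.
Proof.
move=> zc; apply/eqP; rewrite -normr_eq0; apply/eqP.
have c_ge0 := zc 0%N; rewrite mulr0n in c_ge0.
(* The case [n = 0] gives [0 <= c], which in [R[i]] forces [c] to be real. *)
rewrite (_ : c = (complex.Re c)%:C%C) in zc; last first.
  by rewrite RRe_real ?ger0_real.
rewrite norm_complexE in zc *; congr (_%:C%C); apply/eqP.
have [//|z0] := eqVneq (Normc.normc z) 0.
have z_gt0 : 0 < Normc.normc z.
  rewrite -ltcR -norm_complexE normr_gt0.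
  by apply: contra z0 => /eqP ->; rewrite Normc.normc0.
set r := complex.Re c in zc.
have r_ge0 : 0 <= r by have := zc 0%N; rewrite mulr0n ler0c.
have := archi_boundP (divr_ge0 r_ge0 (ltW z_gt0)).
rewrite ltr_pdivrMr // mulr_natl ltNge -lecR.
by rewrite raddfMn /= zc.
Qed.

(** Since [a] equals its modulus, both [n z] and its modulus lie within [c] of [a], so [n (|z| - z)]
    stays bounded by [c + c]. *)
Lemma complex_ge0_natmul_near (R : realType) (z c : R[i]) :
  (forall n, exists2 a, 0 <= a & `|z *+ n - a| <= c) -> 0 <= z.
Proof.
move=> za; suff /eqP : `|z| - z = 0 by rewrite subr_eq0 => /eqP <-.
apply: (@complex_natmul_bounded _ _ (c + c)) => n.
have [a a_ge0 zac] := za n.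
rewrite -normrMn mulrnBl -normrMn.
rewrite -(subrK a `|z *+ n|) -addrA (le_trans (ler_normD _ _)) // lerD //.
  by rewrite (le_trans _ zac) // -{1}(ger0_norm a_ge0) ler_dist_dist.
by rewrite distrC.
Qed.

Lemma sum_inj_le (F : numDomainType) (I I' : finType) (f : I -> I')
    (g : I' -> F) :
  injective f -> (forall i, 0 <= g i) -> \sum_i g (f i) <= \sum_i g i.
Proof.
move=> f_inj g0.
rewrite -(big_imset g (A := predT) (h := f)) /=; last by move=> ? ? _ _ /f_inj.
by rewrite [leRHS](bigID (mem (f @: predT)%SET)) /= lerDl sumr_ge0.
Qed.

(** * Column-substochastic matrices and their powers *)

Definition col_substochastic (F : numDomainType) n (M : 'M[F]_n) :=
  (forall i j, 0 <= M i j) /\ (forall j, \sum_i M i j <= 1).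

Section ColumnSubstochastic.
Context (F : numDomainType) (n : nat) (M : 'M[F]_n).
Hypothesis M_sub : col_substochastic M.

Lemma col_substochastic_le1 i j : M i j <= 1.
Proof.
apply: le_trans (M_sub.2 j); rewrite (bigD1 i) //= lerDl.
by apply: sumr_ge0 => k _; exact: M_sub.1.
Qed.

Lemma col_substochasticX N : col_substochastic (M ^+ N).
Proof.
elim: N => [|N [IH0 IH1]].
  rewrite expr0; split=> [i j|j]; first by rewrite mxE; case: eqP.
  rewrite (bigD1 j) //= mxE eqxx big1 ?addr0 // => i /negPf ij.
  by rewrite mxE ij.
rewrite exprS; split=> [i j|j].
  by rewrite mxE sumr_ge0 // => k _; rewrite mulr_ge0 // M_sub.1.
under eq_bigr do rewrite mxE.
rewrite exchange_big /= (le_trans _ (IH1 j)) // ler_sum // => k _.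
by rewrite -mulr_suml ler_piMl // M_sub.2.
Qed.

End ColumnSubstochastic.

(** The bound does not involve [M], so it is uniform when applied to all powers of one matrix. *)
Lemma col_substochastic_mulmx_norm (F : numDomainType) m n (M : 'M[F]_n)
    (Y : 'M[F]_(n, m)) i j :
  col_substochastic M -> `|(M *m Y) i j| <= \sum_k `|Y k j|.
Proof.
move=> M_sub; rewrite mxE (le_trans (ler_norm_sum _ _ _)) // ler_sum // => k _.
rewrite normrM ger0_norm ?M_sub.1 // ler_piMl //.
exact: col_substochastic_le1.
Qed.

(** * Mean ergodic theorem, with unnormalised Cesaro sums *)

Section ErgodicProjection.
Context (R : realType) (n : nat) (M : 'M[R[i]]_n).
Hypothesis M_sub : col_substochastic M.
Local Notation P := (ker_im_proj (M - 1%:M)).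
Local Notation cesaro := (fun N => \sum_(k < N) M ^+ k).

Lemma cesaro_ge0 N i j : 0 <= cesaro N i j.
Proof.
by rewrite summxE sumr_ge0 // => k _; apply: (col_substochasticX M_sub _).1.
Qed.

(** Telescoping of the geometric sum, whose factors commute. *)
Lemma cesaro_mul_sub1 m (Y : 'M[R[i]]_(n, m)) N :
  cesaro N *m ((M - 1%:M) *m Y) = M ^+ N *m Y - Y.
Proof.
have comm : GRing.comm (M - 1) (cesaro N).
  apply: commr_sum => k _; apply: commrX; apply: commr_sym.
  by apply: commrB; [exact: commr_refl|exact: commr1].
rewrite mulmxA -[cesaro N *m _]/(cesaro N * (M - 1)) -comm -subrX1.
by rewrite mulmxBl mul1mx.
Qed.

Lemma fixed_cesaro m (X : 'M[R[i]]_(n, m)) N :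
  (M - 1%:M) *m X = 0 -> cesaro N *m X = X *+ N.
Proof.
rewrite mulmxBl mul1mx => /eqP; rewrite subr_eq0 => /eqP MX.
rewrite mulmx_suml -[N in RHS]card_ord -sumr_const.
apply: eq_bigr => k _; elim: {k}(k : nat) => [|k IH]; first exact: mul1mx.
by rewrite exprSr -[M ^+ k * M]/(M ^+ k *m M) -mulmxA MX.
Qed.

(* If x = (M - 1) y is fixed, then N x = M^N y - y stays bounded. *)
Lemma ker_im_sub1_disjoint :
  (kermx (M - 1%:M)^T :&: (M - 1%:M)^T)%MS = 0.
Proof.
apply/eqP/rowV0P => u; rewrite sub_capmx => /andP[/sub_kermxP uK /submxP[v uv]].
apply: trmx_inj; rewrite trmx0.
have x0 : (M - 1%:M) *m u^T = 0.
  by apply: trmx_inj; rewrite trmx_mul trmxK uK trmx0.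
have xy : u^T = (M - 1%:M) *m v^T by rewrite uv trmx_mul trmxK.
apply/matrixP => i j; rewrite [RHS]mxE.
pose c := \sum_k `|v^T k j|.
apply: (@complex_natmul_bounded _ _ (c + `|v^T i j|)) => N.
rewrite -normrMn -mulmxnE -(fixed_cesaro N x0) xy cesaro_mul_sub1.
rewrite [X in `|X|]mxE [X in _ + X]mxE (le_trans (ler_normB _ _)) // lerD2r.
exact/col_substochastic_mulmx_norm/col_substochasticX.
Qed.

(** The factor [Y] lets the Cesaro sums telescope against [1%:M - P]. *)
Lemma ker_im_projP :
  (M - 1%:M) *m P = 0 /\ exists Y, 1%:M - P = (M - 1%:M) *m Y.
Proof.
set A := M - 1%:M; have dx : (kermx A^T :&: A^T)%MS = 0 := ker_im_sub1_disjoint.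
split.
  apply: trmx_inj; rewrite trmx_mul trmxK trmx0; apply/sub_kermxP.
  by rewrite -[X in (X <= _)%MS]mul1mx proj_mx_sub.
(* Disjointness and rank-nullity make the sum the whole space. *)
have full : (1%:M <= kermx A^T + A^T)%MS.
  rewrite sub1mx /row_full mxrank_disjoint_sum // mxrank_ker subnK //.
  exact: rank_leq_row.
have /submxP[Y e] := proj_mx_compl_sub full.
exists Y^T; apply: trmx_inj; rewrite trmx_mul trmxK -e mul1mx.
by rewrite linearB /= trmx1 trmxK.
Qed.

(** The Cesaro means tend to [P] at rate [c / N]: the Cesaro sum fixes [P] up to the factor [N], and
    on [1%:M - P] it telescopes to [M ^+ N *m Y - Y], which is bounded. *)
Lemma ker_im_proj_cesaro i j :
  exists c, forall N, `|P i j *+ N - cesaro N i j| <= c.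
Proof.
have [P0 [Y PY]] := ker_im_projP.
exists (\sum_k `|Y k j| + `|Y i j|) => N.
have -> : P i j *+ N - cesaro N i j = - (M ^+ N *m Y - Y) i j.
  rewrite -cesaro_mul_sub1 -PY mulmxBr mulmx1 (fixed_cesaro _ P0).
  by rewrite -mulmxnE [X in _ = - X]mxE [X in _ = - (_ + X)]mxE opprB.
rewrite normrN mxE [X in _ + X]mxE (le_trans (ler_normB _ _)) // lerD2r.
exact/col_substochastic_mulmx_norm/col_substochasticX.
Qed.

Lemma ker_im_proj_ge0 i j : 0 <= P i j.
Proof.
have [c Pc] := ker_im_proj_cesaro i j.
apply: (@complex_ge0_natmul_near _ _ c) => N.
by exists (cesaro N i j) => //; exact: cesaro_ge0.
Qed.

End ErgodicProjection.

(** * Comparison of a matrix with a submatrix *)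

Section Submatrix.
Context (R : realType) (m n : nat) (f : 'I_m -> 'I_n).
Context (A : 'M[R[i]]_m) (B : 'M[R[i]]_n).
Hypothesis f_inj : injective f.
Hypothesis AE : A = mxsub f f B.
Hypothesis B_sub : col_substochastic B.

(** Entries of powers are sums of weights over paths of length [N]; [A] sees only the paths staying
    in the image of [f]. *)
Lemma mxsubX_le N i j : (A ^+ N) i j <= (B ^+ N) (f i) (f j).
Proof.
elim: N i j => [|N IH] i j; first by rewrite !expr0 !mxE (inj_eq f_inj).
rewrite !exprS !mxE.
pose g k := B (f i) k * (B ^+ N) k (f j).
apply: le_trans (sum_inj_le f_inj (g := g) _).
  apply: ler_sum => k _; rewrite AE mxE ler_wpM2l ?B_sub.1 // -AE.
  exact: IH.
by move=> k; rewrite /g mulr_ge0 ?B_sub.1 // (col_substochasticX B_sub _).1.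
Qed.

Lemma ker_im_proj_mxsub_le i j :
  col_substochastic A ->
  ker_im_proj (A - 1%:M) i j <= ker_im_proj (B - 1%:M) (f i) (f j).
Proof.
move=> A_sub; have [c Ac] := ker_im_proj_cesaro A_sub i j.
have [d Bd] := ker_im_proj_cesaro B_sub (f i) (f j).
rewrite -subr_ge0; apply: (@complex_ge0_natmul_near _ _ (d + c)) => N.
exists ((\sum_(k < N) B ^+ k) (f i) (f j) - (\sum_(k < N) A ^+ k) i j).
  by rewrite subr_ge0 !summxE ler_sum // => k _; exact: mxsubX_le.
(* Regroup as the error for [B] minus the error for [A], then use the triangle inequality. *)
rewrite mulrnBl opprB addrACA [X in _ + X]addrC addrACA.
apply: le_trans (lerD (Bd N) (Ac N)).
rewrite -[X in _ <= _ + X]normrN.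
apply: le_trans (ler_normD _ _); rewrite le_eqVlt; apply/orP; left; apply/eqP.
by congr `|_|; rewrite opprB; ring.
Qed.

End Submatrix.

(** * Truncations of a contraction *)

Lemma cvg_real_complex (R : realType) (u : nat -> R) (l : R) :
  u @ \oo --> l -> (fun n => (u n)%:C%C : R[i]^o) @ \oo --> (l%:C%C : R[i]^o).
Proof.
move=> ul; apply/cvgrPdist_lt => e e0.
have er : e = (complex.Re e)%:C%C by rewrite RRe_real ?gtr0_real.
rewrite er ltcR in e0.
near=> n; rewrite er -raddfB /= norm_complexE ltcR /= expr0n addr0 sqrtr_sqr.
by near: n; move/cvgrPdist_lt: ul; apply.
Unshelve. all: by end_near. Qed.

Section TruncatedMatrix.
Context (R : realType) (mu : prob_weight R).

Lemma weighted_sq_ge0 (x : nat -> R[i]) j : 0 <= mu j * Normc.normc (x j) ^+ 2.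
Proof. by rewrite mulr_ge0 ?sqr_ge0 // ltW ?weight_gt0. Qed.

Lemma l2_dot_sq (x : l2 mu) :
  l2_dot x x = (limn (series (fun j => mu j * Normc.normc (x j) ^+ 2)))%:C%C.
Proof.
have /l2_predP/cvg_real_complex cv := l2_funP x.
have {}cv : series (fun j => (mu j)%:C%C * x j * (x j)^* : R[i]^o) @ \oo -->
    ((limn (series (fun j => mu j * Normc.normc (x j) ^+ 2)))%:C%C : R[i]^o).
  apply: cvg_trans cv; apply: near_eq_cvg; near=> n.
  rewrite !seriesEnat raddf_sum; apply: eq_bigr => j _.
  by rewrite /= rmorphM rmorphXn /= -norm_complexE normCK mulrA.
exact: (cvg_lim (@norm_hausdorff _ R[i]^o) cv).
Unshelve. all: by end_near. Qed.

(** The terms are nonnegative, so partial sums for [U x] lie below their limit, which the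
    contraction bounds by the limit for [x]. *)
Lemma l2_contraction_partial_sum (U : {linear l2 mu -> l2 mu}) (x : l2 mu) c n :
  l2_contraction U ->
  (forall m, series (fun j => mu j * Normc.normc (x j) ^+ 2) m <= c) ->
  series (fun j => mu j * Normc.normc (U x j) ^+ 2) n <= c.
Proof.
move=> /(_ x) + xc.
have lim_ge0 (y : l2 mu) :
    0 <= limn (series (fun j => mu j * Normc.normc (y j) ^+ 2)).
  apply: limr_ge; first exact/l2_predP/l2_funP.
  by near=> m; rewrite seriesEnat sumr_ge0 // => j _; exact: weighted_sq_ge0.
rewrite /l2_norm !l2_dot_sq ler_sqrtC ?nnegrE ?ler0c ?lim_ge0 // lecR => Ux.
apply: (@le_trans _ _ (limn (series (fun j => mu j * Normc.normc (x j) ^+ 2)))).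
  apply: le_trans Ux; apply: nondecreasing_cvgn_le; last exact/l2_predP/l2_funP.
  by apply: nondecreasing_series => j _ _; exact: weighted_sq_ge0.
by apply: limr_le; [exact/l2_predP/l2_funP | near=> m].
Unshelve. all: by end_near. Qed.

Lemma extend0_delta J (k : 'I_J) j :
  extend0 (delta_mx k 0 : 'cV[R[i]]_J) j = (j == k)%:R.
Proof.
rewrite /extend0; case: insubP => [i _ <-|]; first by rewrite /= mxE eqxx andbT.
by have [->|//] := eqVneq j (k : nat); rewrite ltn_ord.
Qed.

Lemma trunc_mx_widen (U : l2 mu -> l2 mu) m n (mn : (m <= n)%N) :
  trunc_mx U m = mxsub (widen_ord mn) (widen_ord mn) (trunc_mx U n).
Proof.
apply/matrixP => j k; rewrite !mxE /=.
(* Both basis vectors extend by zero to the same sequence. *)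
by congr (U _ _); apply/val_inj/funext => i; rewrite /= !extend0_delta.
Qed.

(** Column [k] sums to a partial sum of the squared norm of [U x] over [mu k], where [x] is the
    [k]-th basis vector, of squared norm [mu k]. *)
Lemma b_mx_trunc_substochastic (U : {linear l2 mu -> l2 mu}) J :
  l2_contraction U -> col_substochastic (b_mx mu (trunc_mx U J)).
Proof.
move=> hU; have mu_ge0 j : 0 <= mu j by rewrite ltW ?weight_gt0.
split=> [j k|k]; first by rewrite mxE mulr_ge0 ?sqr_ge0 ?divr_ge0.
pose x := l2_extend mu (delta_mx k 0 : 'cV[R[i]]_J).
have -> : \sum_j b_mx mu (trunc_mx U J) j k =
    series (fun j => mu j * Normc.normc (U x j) ^+ 2) J / mu k.
  rewrite seriesEnat /= big_mkord mulr_suml; apply: eq_bigr => j _.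
  by rewrite !mxE mulrAC.
rewrite ler_pdivrMr ?weight_gt0 // mul1r.
apply: l2_contraction_partial_sum => // m.
rewrite seriesEnat /=.
under eq_bigr do rewrite extend0_delta.
rewrite (eq_bigr (fun j => if j == k :> nat then mu k else 0)); last first.
  move=> j _; case: eqP => [->|_]; first by rewrite Normc.normc1 expr1n mulr1.
  by rewrite Normc.normc0 expr0n mulr0.
by rewrite -big_mkcond big_nat1_eq; case: ifP.
Qed.

End TruncatedMatrix.

(** * Termwise comparison of the entropies *)

Lemma col_substochastic_complex (R : realType) n (B : 'M[R]_n) :
  col_substochastic B -> col_substochastic (map_mx (real_complex R) B).
Proof.
move=> [B0 B1]; split=> [i j|j]; first by rewrite mxE ler0c.
under eq_bigr do rewrite mxE.
by rewrite -raddf_sum -(rmorph1 (real_complex R)) lecR.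
Qed.

Theorem theorem8p1 (R : realType) (mu : prob_weight R)
    (U : {linear l2 mu -> l2 mu}) (hU : l2_contraction U)
    (J : nat) (hJ : (1 <= J)%N) :
  entropy mu (trunc_mx U J) <= entropy mu (trunc_mx U J.+1).
Proof.
pose f := widen_ord (leqnSn J).
have f_inj : injective f by move=> i j [] /ord_inj.
pose A := b_mx mu (trunc_mx U J); pose B := b_mx mu (trunc_mx U J.+1).
have AB : A = mxsub f f B.
  (* [f] keeps the numerical index, so the weights in [b_mx] agree as well. *)
  rewrite /A (trunc_mx_widen _ (leqnSn J)).
  by apply/matrixP => j k; rewrite !mxE.
have A_sub : col_substochastic A by exact: b_mx_trunc_substochastic.
have B_sub : col_substochastic B by exact: b_mx_trunc_substochastic.
have Ac_sub := col_substochastic_complex A_sub.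
have Bc_sub := col_substochastic_complex B_sub.
have ABc : map_mx (real_complex R) A = mxsub f f (map_mx (real_complex R) B).
  by rewrite AB map_mxsub.
have mu_ge0 k : 0 <= (mu k)%:C%C by rewrite ler0c ltW ?weight_gt0.
rewrite /entropy -/A -/B.
set P := ker_im_proj (_ A - _); set Q := ker_im_proj (_ B - _).
have P0 i j : 0 <= P i j by exact: ker_im_proj_ge0.
have Q0 i j : 0 <= Q i j by exact: ker_im_proj_ge0.
have PQ i j : P i j <= Q (f i) (f j) by exact: ker_im_proj_mxsub_le.
have rowsE n (X : 'M[R[i]]_n) j :
    (X^T *m const_mx 1 : 'cV_n) j 0 = \sum_i X i j.
  by rewrite mxE; apply: eq_bigr => i _; rewrite !mxE mulr1.
have colsE n (X : 'M[R[i]]_n) k :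
    (X *m \col_i (mu i)%:C%C) k 0 = \sum_i X k i * (mu i)%:C%C.
  by rewrite mxE; apply: eq_bigr => i _; rewrite !mxE.
(* Absorbing the sign into [- t ln t] makes every factor nonnegative. *)
have entropyE n (X : 'M[R[i]]_n) (D : 'M[R]_n) :
    - \sum_j \sum_k (X^T *m const_mx 1 : 'cV_n) j 0 * (D j k)%:C%C *
        (X *m \col_i (mu i)%:C%C) k 0 * (ln (D j k))%:C%C =
    \sum_j \sum_k (\sum_i X i j) * (\sum_i X k i * (mu i)%:C%C) *
        (- (D j k * ln (D j k)))%:C%C.
  rewrite -sumrN; apply: eq_bigr => j _; rewrite -sumrN; apply: eq_bigr => k _.
  rewrite rowsE colsE rmorphN rmorphM /=; ring.
rewrite !entropyE.
have ent_ge0 j k : 0 <= (- (B j k * ln (B j k)))%:C%C.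
  rewrite ler0c oppr_ge0 mulr_ge0_le0 ?B_sub.1 // ln_le0 //.
  exact: col_substochastic_le1.
have colQ_ge0 j : 0 <= \sum_i Q i j by rewrite sumr_ge0.
have rowQ_ge0 k : 0 <= \sum_i Q k i * (mu i)%:C%C.
  by rewrite sumr_ge0 // => i _; rewrite mulr_ge0.
apply: le_trans (sum_inj_le f_inj _); last first.
  by move=> j; rewrite sumr_ge0 // => k _; rewrite !mulr_ge0.
apply: ler_sum => j _.
apply: le_trans (sum_inj_le f_inj _); last first.
  by move=> k; rewrite !mulr_ge0.
(* The logarithmic factor is now common to both sides; only the coefficients from [P] and [Q]
   remain. *)
apply: ler_sum => k _; rewrite AB mxE ler_wpM2r //.
apply: ler_pM.
- by rewrite sumr_ge0.
- by rewrite sumr_ge0 // => i _; rewrite mulr_ge0.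
- apply: le_trans (sum_inj_le f_inj (fun i => Q0 i (f j))).
  exact: ler_sum.
- apply: le_trans (sum_inj_le f_inj _); last first.
    by move=> i; rewrite mulr_ge0.
  by apply: ler_sum => i _; rewrite ler_wpM2r.
Qed.
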